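(* (a) For every $r\in[0;1)$ and every $z\in2^\omega$, the section $\{K\in\mathbf{K}:(K,z,0,r)\in\mathcal{A}_{\le}\}=\{K\in\mathbf{K}:\mu(K)\le r\}$ is $\boldsymbol{\Pi}^0_2$-complete, and hence its complement is $\boldsymbol{\Sigma}^0_2$-complete. Moreover $\mathcal{A}_\le$ is $\boldsymbol{\Pi}^0_2$-complete, $\mathcal{A}_>$ is $\boldsymbol{\Sigma}^0_2$-complete, and $\mathcal{A}$ is $\boldsymbol{\Pi}^0_2$-complete. (b) $\mathcal{B}^-_{\le}$ is $\boldsymbol{\Pi}^0_2$-complete, $\mathcal{B}^-_{\ge}$ is $\boldsymbol{\Pi}^0_3$-complete, $\mathcal{B}^-_{>}$ is $\boldsymbol{\Sigma}^0_2$-complete, $\mathcal{B}^-_<$ is $\boldsymbol{\Sigma}^0_3$-complete, and $\mathcal{B}$ is $\boldsymbol{\Pi}^0_3$-hard.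
   Context: $2^{\omega}$ is the Cantor space; $N_s=\{x\in2^\omega:s\subset x\}$; $\mu$ is the coin-tossing measure, $\mu(N_s)=2^{-\mathrm{lh}(s)}$. $\mathbf{K}$ is the Polish space of compact subsets of $2^\omega$ with the Vietoris topology. For compact $K$ and $z\in2^\omega$: $\mathcal{D}^+_K(z)=\limsup_n\mu(K\cap N_{z\restriction n})/\mu(N_{z\restriction n})$, $\mathcal{D}^-_K(z)=\liminf_n$ of the same ratios, and $\mathcal{D}_K(z)$ is the limit when it exists. For $\bowtie$ one of $<,>,\le,\ge$: $\mathcal{A}_\bowtie=\{(K,z,n,r)\in\mathbf{K}\times2^\omega\times\omega\times[0;1]:\mu(K\cap N_{z\restriction n})\bowtie r\}$, $\mathcal{A}=\{(K,z,n,r):\mu(K\cap N_{z\restriction n})=r\}$, $\mathcal{B}^\pm_\bowtie=\{(K,z,r)\in\mathbf{K}\times2^\omega\times[0;1]:\mathcal{D}^\pm_K(z)\bowtie r\}$, $\mathcal{B}=\{(K,z,r):\mathcal{D}_K(z)=r\}$ (with $\mathcal{D}_K(z)$ existing). $\omega$ is discrete. A set $A\subseteq X$ is $\boldsymbol{\Gamma}$-hard if for every zero-dimensional Polish $Z$ and $B\in\boldsymbol{\Gamma}(Z)$ there is continuous $f:Z\to X$ with $B=f^{-1}(A)$; $\boldsymbol{\Gamma}$-complete if moreover $A\in\boldsymbol{\Gamma}(X)$. *)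

(* Defs.v *)
From HB Require Import structures.
From mathcomp Require Import all_boot all_order all_algebra.
From mathcomp Require Import all_classical all_reals all_analysis.
Set Implicit Arguments. Unset Strict Implicit. Unset Printing Implicit Defensive.
Import Order.TTheory GRing.Theory Num.Theory.
Import numFieldTopology.Exports.
Local Open Scope classical_set_scope.
Local Open Scope ring_scope.

Fixpoint Sigma0 (T : topologicalType) (k : nat) : set (set T) :=
  match k with
  | 0 => set0
  | 1 => [set A | open A]
  | (S k') as k1 => [set A | exists F : nat -> set T,
                        (forall i, Sigma0 k' (~` F i)) /\ A = \bigcup_i F i]
  end.

Definition Pi0 (T : topologicalType) (k : nat) : set (set T) :=
  [set A | Sigma0 k (~` A)].

Definition polish (R : realType) (Z : topologicalType) : Prop :=
  (exists D : set Z, countable D /\ dense D) /\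
  exists d : Z -> Z -> R,
    [/\ (forall x y, d x y = 0 <-> x = y),
        (forall x y, d x y = d y x),
        (forall x y w, d x w <= d x y + d y w),
        (forall A : set Z, open A <->
           (forall x, A x -> exists2 e : R, 0 < e & [set y | d x y < e] `<=` A)) &
        (forall u : nat -> Z,
           (forall e : R, 0 < e -> exists N : nat, forall m n : nat,
              (N <= m)%N -> (N <= n)%N -> d (u m) (u n) < e) ->
           exists x : Z, u @ \oo --> x)].

Definition zero_dim (Z : topologicalType) : Prop :=
  forall (U : set Z) (x : Z), open U -> U x ->
    exists V : set Z, [/\ clopen V, V x & V `<=` U].

Definition Gamma_hard (R : realType)
    (Gamma : forall T : topologicalType, set (set T))
    (X : topologicalType) (A : set X) : Prop :=
  forall (Z : topologicalType), polish R Z -> zero_dim Z ->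
  forall B : set Z, Gamma Z B ->
  exists f : Z -> X, continuous f /\ B = f @^-1` A.

Definition Gamma_complete (R : realType)
    (Gamma : forall T : topologicalType, set (set T))
    (X : topologicalType) (A : set X) : Prop :=
  Gamma X A /\ Gamma_hard R Gamma A.

Definition SIGMA0 (k : nat) : forall T : topologicalType, set (set T) :=
  fun T => @Sigma0 T k.
Definition PI0 (k : nat) : forall T : topologicalType, set (set T) :=
  fun T => @Pi0 T k.

Definition hyperspace : Type := {K : set cantor_space | compact K}.

HB.instance Definition _ := gen_eqMixin hyperspace.
HB.instance Definition _ := gen_choiceMixin hyperspace.

Definition vietoris_subbase (p : set cantor_space * bool) : set hyperspace :=
  if p.2 then [set K | sval K `<=` p.1]
  else [set K | sval K `&` p.1 !=set0].

HB.instance Definition _ := isSubBaseTopological.Build hyperspace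
  [set p : set cantor_space * bool | open p.1] vietoris_subbase.

Definition cyl (s : seq bool) : set cantor_space :=
  [set x | forall i, (i < size s)%N -> x i = nth false s i].

Definition restr (z : cantor_space) (n : nat) : seq bool := mkseq z n.

(* mu = the outer measure generated by mu(N_s) = 2^-lh(s) on cylinders
   (restricted to Borel sets this is the coin-tossing measure) *)
Definition cyl_weight (R : realType) (s : seq bool) : \bar R :=
  (((2 : R) ^+ size s)^-1)%:E.

Definition mu (R : realType) (A : set cantor_space) : \bar R :=
  ereal_inf [set (\sum_(0 <= i <oo) cyl_weight R (s i))%E
            | s in [set s : nat -> seq bool | A `<=` \bigcup_i cyl (s i)]].

Definition unit01 (R : realType) : set R := [set x | 0 <= x <= 1].
Definition I01 (R : realType) : Type := @set_type R (@unit01 R).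

Definition muKN (R : realType) (K : hyperspace) (z : cantor_space) (n : nat) : \bar R :=
  mu R (sval K `&` cyl (restr z n)).

Definition A_le (R : realType) : set (hyperspace * cantor_space * nat * I01 R) :=
  [set p | (muKN R p.1.1.1 p.1.1.2 p.1.2 <= (sval p.2)%:E)%E].
Definition A_gt (R : realType) : set (hyperspace * cantor_space * nat * I01 R) :=
  [set p | ((sval p.2)%:E < muKN R p.1.1.1 p.1.1.2 p.1.2)%E].
Definition A_eq (R : realType) : set (hyperspace * cantor_space * nat * I01 R) :=
  [set p | muKN R p.1.1.1 p.1.1.2 p.1.2 = (sval p.2)%:E].

Definition dens_ratio (R : realType) (K : hyperspace) (z : cantor_space) (n : nat) : \bar R :=
  (fine (muKN R K z n) / fine (mu R (cyl (restr z n))))%:E.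

Definition Dminus (R : realType) (K : hyperspace) (z : cantor_space) : \bar R :=
  limn_einf (dens_ratio R K z).
Definition Dplus (R : realType) (K : hyperspace) (z : cantor_space) : \bar R :=
  limn_esup (dens_ratio R K z).

Definition Bm_le (R : realType) : set (hyperspace * cantor_space * I01 R) :=
  [set p | (Dminus R p.1.1 p.1.2 <= (sval p.2)%:E)%E].
Definition Bm_ge (R : realType) : set (hyperspace * cantor_space * I01 R) :=
  [set p | ((sval p.2)%:E <= Dminus R p.1.1 p.1.2)%E].
Definition Bm_gt (R : realType) : set (hyperspace * cantor_space * I01 R) :=
  [set p | ((sval p.2)%:E < Dminus R p.1.1 p.1.2)%E].
Definition Bm_lt (R : realType) : set (hyperspace * cantor_space * I01 R) :=
  [set p | (Dminus R p.1.1 p.1.2 < (sval p.2)%:E)%E].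
Definition B_eq (R : realType) : set (hyperspace * cantor_space * I01 R) :=
  [set p | dens_ratio R p.1.1 p.1.2 @ \oo --> (sval p.2)%:E].

Arguments polish R Z : clear implicits.
Arguments Gamma_hard R Gamma {X} A.
Arguments Gamma_complete R Gamma {X} A.
Arguments mu R A : clear implicits.
Arguments muKN R K z n : clear implicits.
Arguments A_le R _ : clear implicits.
Arguments A_gt R _ : clear implicits.
Arguments A_eq R _ : clear implicits.
Arguments dens_ratio R K z n : clear implicits.
Arguments Dminus R K z : clear implicits.
Arguments Dplus R K z : clear implicits.
Arguments Bm_le R _ : clear implicits.
Arguments Bm_ge R _ : clear implicits.
Arguments Bm_gt R _ : clear implicits.
Arguments Bm_lt R _ : clear implicits.
Arguments B_eq R _ : clear implicits.

(* Main.v *)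
(* For compact K, mu(K) is the infimum over n of the proportion of words of length
   n whose cylinder meets K, and each such proportion is a locally constant
   function of K; hence K |-> mu(K) is upper semicontinuous and all the upper
   bounds follow by counting quantifiers.

   For hardness, a Pi^0_2 subset of a zero-dimensional Polish space Z is the set
   of z for which a sequence x(z) of bits depending continuously on z contains
   infinitely many ones.  For (a), let K(x) be the union of the set of points
   whose binary value is at most r and of the set of y such that y_i = 1 whenever
   x_i = 1: the second set is null iff x has infinitely many ones, and otherwise
   contains cylinders N_(1^M) disjoint from the first one.  For (b), let K(x, m) be
   the set of points that do not begin with 0^k 1 0^(m k) for any k with x_k = 1.
   Its density at 0^omega over N_(0^n) is at most 1 - 2^-(m n + 1) if x_n = 1, and
   at least 1 - 2^-M if m k >= M for all k >= n with x_k = 1.  Taking m = 0 and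
   r = 1/2 gives Pi^0_2-hardness; for a Pi^0_3 set, x collects one row of bits for
   each of the Pi^0_2 sets whose complements it intersects, m k is the row of k,
   and the density is 1 iff each row contains finitely many ones. *)
Require Import Defs.
From HB Require Import structures.
From mathcomp Require Import all_boot all_order all_algebra.
From mathcomp Require Import all_classical all_reals all_analysis.
From mathcomp Require Import ring lra zify.
From Stdlib Require Cantor.
Import Order.TTheory GRing.Theory Num.Theory.
Import numFieldTopology.Exports.
Local Open Scope classical_set_scope.
Local Open Scope ring_scope.

(** * Averages over binary words *)

Section Average.
Variable R : realFieldType.
Implicit Types (f g : seq bool -> R) (P Q : pred (seq bool)) (u s : seq bool).

(** The recursion splits off the first letter, so that the step of an induction passes from a tree
    to its two subtrees. *)
Fixpoint avg n f : R :=
  if n is n'.+1 then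
    (avg n' (fun s => f (false :: s)) + avg n' (fun s => f (true :: s))) / 2
  else f [::].

Definition freq n P : R := avg n (fun s => (P s)%:R).

Lemma eq_avg n f g : (forall s, size s = n -> f s = g s) -> avg n f = avg n g.
Proof.
elim: n f g => [|n IH] f g fg /=; first exact: fg.
by congr ((_ + _) / 2); apply: IH => s sn; apply: fg; rewrite /= sn.
Qed.

Lemma le_avg n f g :
  (forall s, size s = n -> f s <= g s) -> avg n f <= avg n g.
Proof.
elim: n f g => [|n IH] f g fg /=; first exact: fg.
rewrite ler_pM2r ?invr_gt0// lerD//;
  by apply: IH => s sn; apply: fg; rewrite /= sn.
Qed.

Lemma avg_cst n c : avg n (fun=> c) = c.
Proof. by elim: n => //= n ->; field. Qed.

Lemma avgD n f g : avg n (fun s => f s + g s) = avg n f + avg n g.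
Proof. by elim: n f g => //= n IH f g; rewrite !IH; field. Qed.

Lemma avg_sum n (I : Type) (r : seq I) (F : I -> seq bool -> R) :
  avg n (fun s => \sum_(i <- r) F i s) = \sum_(i <- r) avg n (F i).
Proof.
elim: r => [|i r IH].
  by rewrite big_nil -[RHS](avg_cst n 0); apply: eq_avg => s _; rewrite big_nil.
rewrite big_cons -IH -avgD; apply: eq_avg => s _; exact: big_cons.
Qed.

Lemma eq_freq n P Q :
  (forall s, size s = n -> P s = Q s) -> freq n P = freq n Q.
Proof. by move=> PQ; apply: eq_avg => s /PQ ->. Qed.

Lemma le_freq n P Q :
  (forall s, size s = n -> P s -> Q s) -> freq n P <= freq n Q.
Proof.
move=> PQ; apply: le_avg => s /PQ; rewrite ler_nat.
by case: (P s) (Q s) => [] [] // /(_ isT).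
Qed.

Lemma freqT n : freq n predT = 1. Proof. exact: avg_cst. Qed.

Lemma freq0 n : freq n pred0 = 0. Proof. exact: avg_cst. Qed.

Lemma freq_ge0 n P : 0 <= freq n P.
Proof. by rewrite -(freq0 n); apply: le_freq. Qed.

Lemma freq_le1 n P : freq n P <= 1.
Proof. by rewrite -(freqT n); apply: le_freq. Qed.

Lemma freqS n P : freq n.+1 P =
  (freq n (fun s => P (false :: s)) + freq n (fun s => P (true :: s))) / 2.
Proof. by []. Qed.

Lemma freqC n P : freq n (fun s => ~~ P s) = 1 - freq n P.
Proof.
rewrite -(freqT n); apply/eqP; rewrite eq_sym subr_eq /freq -avgD.
by apply/eqP/eq_avg => s _ /=; case: (P s); rewrite ?(addr0, add0r).
Qed.

Lemma freq_or n P Q : (forall s, size s = n -> P s -> ~~ Q s) ->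
  freq n (fun s => P s || Q s) = freq n P + freq n Q.
Proof.
move=> PQ; rewrite /freq -avgD; apply: eq_avg => s /PQ.
by case: (P s) (Q s) => [] [] H; rewrite ?(addr0, add0r)//; have := H isT.
Qed.

(** Fixing the first [size u] letters leaves the last [j] free: the frequency relative to the
    cylinder of [u] gets scaled by its measure. *)
Lemma freq_prefix u j P :
  freq (size u + j) (fun s => prefix u s && P s) =
  2 ^- size u * freq j (fun s => P (u ++ s)).
Proof.
elim: u P => [|b u IH] P /=; first rewrite expr0 invr1 mul1r.
  by apply: eq_freq => s; rewrite prefix0s.
rewrite addSn freqS; case: b => /=.
- rewrite [X in X + _](_ : _ = 0); last first.
    by rewrite -(freq0 (size u + j)); apply: eq_freq.
  rewrite (IH (fun s => P (true :: s))) add0r exprS invfM; ring.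
- rewrite [X in _ + X](_ : _ = 0); last first.
    by rewrite -(freq0 (size u + j)); apply: eq_freq.
  rewrite (IH (fun s => P (false :: s))) addr0 exprS invfM; ring.
Qed.

Lemma freq_prefix1 u n : (size u <= n)%N -> freq n (prefix u) = 2 ^- size u.
Proof.
move=> un; rewrite -(subnKC un).
transitivity (freq (size u + (n - size u)) (fun s => prefix u s && predT s)).
  by apply: eq_freq => s _; rewrite andbT.
by rewrite freq_prefix [X in _ * X]freqT mulr1.
Qed.

Lemma freq_or_le n P Q :
  freq n (fun s => P s || Q s) <= freq n P + freq n Q.
Proof.
rewrite /freq -avgD; apply: le_avg => s _; rewrite -natrD ler_nat.
by case: (P s) (Q s) => [] [].
Qed.

End Average.

(** * Binary values of words *)

Section BinaryValue.
Variable R : realFieldType.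

Fixpoint bval (s : seq bool) : R :=
  if s is b :: s' then (b%:R + bval s') / 2 else 0.

Lemma bval_ge0 s : 0 <= bval s.
Proof. by elim: s => //= b s IH; rewrite divr_ge0// addr_ge0. Qed.

Lemma bval_le1 s : bval s <= 1.
Proof.
by elim: s => [|[] s IH] /=; rewrite ?ler01//; move: IH; rewrite ?mulr1n ?mulr0n; lra.
Qed.

Lemma bval_rcons s b : bval s <= bval (rcons s b).
Proof.
elim: s => [|c s IH] /=; first by rewrite addr0 divr_ge0.
by rewrite ler_pM2r ?invr_gt0// lerD2l.
Qed.

Lemma bval_rcons_false s : bval (rcons s false) = bval s.
Proof. by elim: s => [|c s IH] /=; rewrite ?IH// addr0 mul0r. Qed.

Lemma bval_ones N s : prefix (nseq N true) s -> 1 - 2 ^- N <= bval s.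
Proof.
elim: N s => [|N IH] s; first by rewrite expr0 invr1 subrr bval_ge0.
by case: s => [|[] s] //= /IH; rewrite exprS invfM mulr1n; lra.
Qed.

(** Removing the first letter turns the bound [r] into [2 * r] or [2 * r - 1]. If [2 * r <= 1], the
    words beginning with 0 suffice; otherwise all of these count and the words beginning with 1
    supply the rest. *)
Lemma freq_bval_ge n (r : R) : r <= 1 -> r <= freq R n (fun s => bval s <= r).
Proof.
elim: n r => [|n IH] r r1.
  rewrite /freq /=; case: (lerP 0 r) => //= r0; exact: ltW.
rewrite freqS /=.
set a := freq R n _; set b := freq R n _.
have a0 : 0 <= a by exact: freq_ge0.
have b0 : 0 <= b by exact: freq_ge0.
have [r2|r2] := lerP (2 * r) 1.
  have : 2 * r <= a.
    apply: le_trans (IH _ r2) _; apply: le_freq => s _ /=.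
    by rewrite mulr0n; lra.
  lra.
have : 1 <= a.
  rewrite -[leLHS](freqT R n); apply: le_freq => s _ _ /=.
  by have := bval_le1 s; rewrite mulr0n; lra.
have : 2 * r - 1 <= b.
  have /IH : 2 * r - 1 <= 1 by lra.
  move/le_trans; apply; apply: le_freq => s _ /=.
  by rewrite mulr1n; lra.
lra.
Qed.

(** The hypothesis says that the right-hand side is nonnegative. In the step, either [2 * r - 1]
    satisfies it again, or no word beginning with 1 counts because values are nonnegative. *)
Lemma freq_bval_le n (r : R) :
  - 2 ^- n <= r -> freq R n (fun s => bval s <= r) <= r + 2 ^- n.
Proof.
elim: n r => [|n IH] r.
  rewrite expr0 invr1 /freq /= => r1.
  by case: (lerP 0 r) => r0 /=; rewrite ?mulr1n ?mulr0n; lra.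
rewrite exprS invfM freqS /= => rn.
set a := freq R n _; set b := freq R n _.
have n0 : 0 <= 2 ^- n :> R by rewrite invr_ge0 exprn_ge0.
have aE : a = freq R n (fun s => bval s <= 2 * r).
  by apply: eq_freq => s _; apply/idP/idP; rewrite /= mulr0n; lra.
have bE : b = freq R n (fun s => bval s <= 2 * r - 1).
  by apply: eq_freq => s _; apply/idP/idP; rewrite /= mulr1n; lra.
have [r2|r2] := lerP (- 2 ^- n) (2 * r - 1).
  have := IH _ r2; rewrite -bE.
  have : a <= 1 by exact: freq_le1.
  lra.
have -> : b = 0.
  rewrite bE -[RHS](freq0 R n); apply: eq_freq => s _; apply/negbTE.
  rewrite -ltNge; apply: lt_le_trans r2 _.
  by have := bval_ge0 s; lra.
have /IH : - 2 ^- n <= 2 * r by lra.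
rewrite -aE; lra.
Qed.

End BinaryValue.

(** * Words of the two trees used for hardness *)

Section Trees.
Implicit Types (x : nat -> bool) (m : nat -> nat) (s : seq bool).

Fixpoint pinned x s :=
  if s is b :: s' then (x 0%N ==> b) && pinned (x \o succn) s' else true.

Lemma pinned_rcons x s b : pinned x (rcons s b) -> pinned x s.
Proof. by elim: s x => //= c s IH x /andP[-> /IH]. Qed.

Lemma pinned_rcons_true x s : pinned x s -> pinned x (rcons s true).
Proof.
elim: s x => [|c s IH] x /=; first by rewrite implybT.
by move=> /andP[-> /IH].
Qed.

Lemma pinned_ones x N s :
  (forall k, (N <= k)%N -> ~~ x k) -> prefix (nseq N true) s -> pinned x s.
Proof.
elim: s x N => //= b s IH x N xN bs.
have xN' : forall k, (N.-1 <= k)%N -> ~~ (x \o succn) k.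
  by move=> k Nk; apply: xN; case: (N) Nk.
case: N xN xN' bs => [|N] xN xN' /=.
  move=> _; rewrite (negbTE (xN 0%N isT)) /=; apply: (IH _ 0%N) => //.
  by rewrite prefix0s.
by move=> /andP[/eqP <- /(IH _ _ xN') ->]; rewrite implybT.
Qed.

(** Each one of [x] among the first [n] places forces a letter and so halves the frequency. *)
Lemma freq_pinned (R : realFieldType) n x :
  freq R n (pinned x) = 2 ^- (\sum_(i < n) x i)%N.
Proof.
elim: n x => [|n IH] x; first by rewrite big_ord0 expr0 invr1.
rewrite freqS big_ord_recl exprD invfM.
rewrite -(IH (x \o succn)) /=; case: (x 0%N) => /=.
  by rewrite [X in X + _](freq0 R n) add0r expr1 mulrC.
by rewrite expr0 invr1 mul1r; field.
Qed.

(* s does not begin with 0^k 1 0^(m k) for any k such that x k. *)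
Fixpoint comb_word x m s :=
  match s with
  | [::] => true
  | false :: s' => comb_word (x \o succn) (m \o succn) s'
  | true :: s' => ~~ (x 0%N && prefix (nseq (m 0%N) false) s')
  end.

Lemma comb_word_rcons x m s b : comb_word x m (rcons s b) -> comb_word x m s.
Proof.
elim: s x m => // -[] s IH x m /=; last exact: IH.
apply: contra => /andP[-> /= /prefix_trans -> //].
exact: prefix_rcons.
Qed.

(** A word of zeros can be followed by 0; once a 1 has occurred, appending another 1 cannot complete
    a forbidden block of zeros. *)
Lemma comb_word_extend x m s : comb_word x m s -> exists b, comb_word x m (rcons s b).
Proof.
elim: s x m => [|[] s IH] x m /=; [by exists false| |exact: IH].
rewrite negb_and => /orP[/negbTE->|ms]; first by exists true.
exists true; rewrite negb_and; apply/orP; right; apply: contra ms.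
elim: s (m 0%N) {IH} => [|c s IH] [|k]; rewrite ?prefix0s//=.
by move=> /andP[-> /IH ->].
Qed.

Lemma comb_word_zeros x m n s : comb_word x m (nseq n false ++ s) =
  comb_word (fun k => x (n + k)%N) (fun k => m (n + k)%N) s.
Proof. by elim: n x m => //= n IH x m; rewrite IH. Qed.

Variable R : realFieldType.

(** The single word 1 followed by [m 0] zeros, of length [m 0 + 1], is excluded. *)
Lemma freq_comb_word_le x m : x 0%N ->
  freq R (m 0%N).+1 (comb_word x m) <= 1 - 2 ^- (m 0%N).+1.
Proof.
move=> x0; rewrite freqS /= x0 /= exprS invfM.
have := freqC R (m 0%N) (prefix (nseq (m 0%N) false)).
rewrite freq_prefix1 ?size_nseq// => ->.
have := freq_le1 R (m 0%N) (comb_word (x \o succn) (m \o succn)).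
lra.
Qed.

(** Among the words beginning with 1, at most the proportion [2 ^- M] is excluded, namely those that
    continue with [m 0 >= M] zeros; the words beginning with 0 are covered by induction. *)
Lemma freq_comb_word_ge x m M n :
  (forall k, x k -> (M <= m k)%N) -> 1 - 2 ^- M <= freq R n (comb_word x m).
Proof.
have M0 : 0 <= 2 ^- M :> R by rewrite invr_ge0 exprn_ge0.
elim: n x m => [|n IH] x m xm.
  by rewrite /freq /= mulr1n; lra.
rewrite freqS /=.
have := IH (x \o succn) (m \o succn) (fun k => xm k.+1).
set a := freq R n _; set b := freq R n _ => ab.
suff : 1 - 2 ^- M <= b by move: ab; rewrite -/a; lra.
have [x0|x0] := boolP (x 0%N); last first.
  by rewrite /b (negbTE x0) /= [leRHS](freqT R n); lra.
rewrite /b x0 /= [leRHS]freqC lerB//.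
have [mn|mn] := leqP (m 0%N) n.
  rewrite freq_prefix1 ?size_nseq// lef_pV2 ?posrE ?exprn_gt0//.
  by rewrite ler_weXn2l ?ler1n//; exact: xm.
(* Here [m 0 > n], and words of length [n] are too short to contain the forbidden block. *)
rewrite [leLHS](_ : _ = 0)// -[RHS](freq0 R n); apply: eq_freq => s sn.
apply/negbTE/negP => /size_prefix.
by rewrite size_nseq sn leqNgt mn.
Qed.

End Trees.

(** * Cantor space *)

(** This is continuity into the discrete space [A], stated without equipping [A] with a topology. *)
Definition loc_cst {T : topologicalType} {A : Type} (f : T -> A) :=
  forall z, \forall w \near z, f w = f z.

Lemma loc_cst_comp {T : topologicalType} {A B : Type} (g : A -> B) (f : T -> A) :
  loc_cst f -> loc_cst (g \o f).
Proof. by move=> f_lc z; apply: filterS (f_lc z) => w /= ->. Qed.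

Lemma loc_cst2 {T : topologicalType} {A B C : Type} (h : A -> B -> C)
    (f : T -> A) (g : T -> B) :
  loc_cst f -> loc_cst g -> loc_cst (fun z => h (f z) (g z)).
Proof. by move=> fl gl z; apply: filterS2 (fl z) (gl z) => w -> ->. Qed.

Lemma near_seq {T : topologicalType} {I : eqType} {A : Type} (f : T -> I -> A)
    (l : seq I) : (forall i, loc_cst (fun z => f z i)) ->
  forall z, \forall w \near z, {in l, f w =1 f z}.
Proof.
move=> fl z; elim: l => [|i l IH]; first exact: filterE.
apply: filterS2 IH (fl i z) => w wl wi t.
by rewrite inE => /orP[/eqP ->|/wl].
Qed.

Lemma loc_cst_mkseq {T : topologicalType} {A : Type} (x : T -> nat -> A) n :
  (forall i, loc_cst (fun z => x z i)) -> loc_cst (fun z => mkseq (x z) n).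
Proof.
by move=> xl z; apply: filterS (near_seq _ (iota 0 n) xl z) => w /eq_in_map.
Qed.

Lemma open_loc_cst {T : topologicalType} {A : Type} (f : T -> A) (P : A -> Prop) :
  loc_cst f -> open [set z | P (f z)].
Proof.
by move=> fl; rewrite openE => z /= Pz; apply: filterS (fl z) => w /= ->.
Qed.

Lemma closed_loc_cst {T : topologicalType} {A : Type} (f : T -> A) (P : A -> Prop) :
  loc_cst f -> closed [set z | P (f z)].
Proof.
move=> fl; rewrite -openC; exact: (@open_loc_cst _ _ f (fun a => ~ P a)).
Qed.

Lemma loc_cst_bool {T : topologicalType} (f : T -> bool) :
  clopen [set z | f z] -> loc_cst f.
Proof.
move=> [fo fc] z; case fz : (f z).
  by apply: open_nbhs_nbhs; split.
have : open_nbhs z (~` [set z | f z]) by split; [exact: closed_openC|rewrite /= fz].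
by move=> /open_nbhs_nbhs; apply: filterS => w /= /negP/negbTE.
Qed.

Lemma loc_cst_cantor i : loc_cst (fun y : cantor_space => y i).
Proof.
move=> y.
have /(_ [set b | b = y i]) := @proj_continuous nat (fun=> bool) i y.
by apply; exact/discrete_set1.
Qed.

Lemma loc_cst_restr n : loc_cst (fun y : cantor_space => restr y n).
Proof. by apply: loc_cst_mkseq => i; exact: loc_cst_cantor. Qed.

Lemma restr_le (y w : cantor_space) m n :
  (m <= n)%N -> restr y n = restr w n -> restr y m = restr w m.
Proof.
move=> mn e; apply/eq_in_map => i; rewrite mem_iota add0n => /= im.
have := congr1 (nth false ^~ i) e.
by rewrite !nth_mkseq// (leq_trans im mn).
Qed.

Lemma nbhs_cantor (y : cantor_space) (U : set cantor_space) :
  nbhs y U -> exists n, forall w : cantor_space, restr w n = restr y n -> U w.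
Proof.
pose G := [set A : set cantor_space |
  exists n, forall w : cantor_space, restr w n = restr y n -> A w].
have FG : Filter G.
  split; first by exists 0%N.
    move=> A B [n nA] [m mB]; exists (maxn n m) => w e; split.
      by apply/nA/restr_le/e/leq_maxl.
    by apply/mB/restr_le/e/leq_maxr.
  by move=> A B AB [n nA]; exists n => w /nA/AB.
suff : cvg_to G (nbhs y) by apply.
(* The product topology is the supremum of the coordinate topologies, so it is enough to treat a
   condition on the single coordinate [i], which level [i.+1] decides. *)
apply/cvg_sup => i V [B [[C oC <-] /= Cy] BV].
exists i.+1 => w /(congr1 (nth false ^~ i)).
by rewrite !nth_mkseq// => e; apply: BV; rewrite /= e.
Qed.

Lemma cylP s (y : cantor_space) : cyl s y <-> restr y (size s) = s.
Proof.
split=> [sy|<- i]; last by rewrite size_mkseq => im; rewrite nth_mkseq.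
apply: (@eq_from_nth _ false); rewrite size_mkseq// => i im.
by rewrite nth_mkseq// sy.
Qed.

Lemma cyl_restr (y : cantor_space) n : cyl (restr y n) y.
Proof. by apply/cylP; rewrite size_mkseq. Qed.

Lemma prefix_restr s (y : cantor_space) n :
  (size s <= n)%N -> prefix s (restr y n) <-> cyl s y.
Proof.
move=> sn; rewrite prefixE /restr /mkseq -map_take take_iota (minn_idPl sn).
by split=> [/eqP/cylP|/cylP/eqP].
Qed.

Lemma open_cyl s : open (cyl s).
Proof.
rewrite (_ : cyl s = [set y | restr y (size s) = s]).
  exact: (open_loc_cst _ (fun t => t = s) (loc_cst_restr (size s))).
by apply/seteqP; split=> y /cylP.
Qed.

Lemma closed_cyl s : closed (cyl s).
Proof.
rewrite (_ : cyl s = [set y | restr y (size s) = s]).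
  exact: (closed_loc_cst _ (fun t => t = s) (loc_cst_restr (size s))).
by apply/seteqP; split=> y /cylP.
Qed.

Lemma compact_closed_cantor (K : set cantor_space) : closed K -> compact K.
Proof.
move=> cK; rewrite -[K]setTI; apply: compact_closedI => //.
exact: cantor_space_compact.
Qed.

(** A level that serves [y] also serves every point agreeing with [y] up to that level, and so does
    every larger level; compactness then gives one level for all of [K]. *)
Lemma compact_level (K U : set cantor_space) : compact K -> open U -> K `<=` U ->
  exists n, forall y w : cantor_space, K y -> restr w n = restr y n -> U w.
Proof.
move=> /compact_near_coveringP cK oU KU.
have [|N _ NP] := cK nat \oo
  (fun n y => forall w : cantor_space, restr w n = restr y n -> U w) _.
  move=> y /KU Uy.
  have [|N NP] := @nbhs_cantor y U; first exact: open_nbhs_nbhs.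
  exists ([set w : cantor_space | restr w N = restr y N], [set n | (N <= n)%N]).
    by split; [exact: loc_cst_restr|exists N].
  move=> [w n] /= [wy Nn] v vw; apply: NP; rewrite -wy.
  exact: restr_le Nn vw.
by exists N => y w Ky; exact: (NP N (leqnn N) y Ky).
Qed.

(** * Measure of compact sets *)

Section Measure.
Variable R : realType.
Implicit Types (K : set cantor_space) (s u : seq bool).

Definition hits K s : bool := `[< K `&` cyl s !=set0 >].

Fixpoint words n : seq (seq bool) :=
  if n is n'.+1 then map (cons false) (words n') ++ map (cons true) (words n')
  else [:: [::]].

Lemma mem_words n s : size s = n -> s \in words n.
Proof.
elim: n s => [|n IH] [|b s]//= [/IH sn]; rewrite mem_cat.
by case: b; apply/orP; [right|left]; apply: map_f.
Qed.

Lemma freqE n (P : pred (seq bool)) :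
  freq R n P = \sum_(s <- words n | P s) 2 ^- size s.
Proof.
elim: n P => [|n IH] P.
  by rewrite /freq /= big_mkcond big_seq1 /=; case: (P _); rewrite ?expr0 ?invr1.
rewrite freqS !IH /= big_cat /= !big_map mulrDl !mulr_suml.
by congr (_ + _); apply: eq_bigr => s _; rewrite /= exprS invfM mulrC.
Qed.

Lemma cyl_weight_ge0 s : (0 <= cyl_weight R s)%E.
Proof. by rewrite lee_fin invr_ge0 exprn_ge0. Qed.

Lemma mu_ge0 (A : set cantor_space) : (0 <= mu R A)%E.
Proof.
apply: le_ereal_inf_tmp => _ [s _ <-].
by apply: nneseries_ge0 => n _ _; exact: cyl_weight_ge0.
Qed.

(* Every cylinder has positive weight, so a finite cover has to be padded to a
   sequence by cylinders of small total weight. *)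
Lemma mu_finite_cover (A : set cantor_space) (l : seq (seq bool)) :
  (forall y, A y -> exists2 s, s \in l & cyl s y) ->
  (mu R A <= (\sum_(s <- l) 2 ^- size s)%:E)%E.
Proof.
move=> Al; apply/lee_addgt0Pr => e e0.
have [p pe] : exists p, 2 ^- p <= e.
  have [p] := ltr_add_invr e0; rewrite add0r => /ltW pe; exists p.
  apply: le_trans pe; rewrite lef_pV2 ?posrE ?exprn_gt0//.
  rewrite -natrX ler_nat; exact: ltn_expl.
pose t i := if (i < size l)%N then nth [::] l i else nseq (p + i.+1) false.
pose A_ i := if (i < size l)%N then cyl_weight R (nth [::] l i) else 0%E.
have A0 i : (0 <= A_ i)%E by rewrite /A_; case: ifP => // _; exact: cyl_weight_ge0.
have -> : (\sum_(s <- l) 2 ^- size s)%:E = (\sum_(0 <= i <oo) A_ i)%E.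
  rewrite (nneseries_split 0 (size l))// eseries0 ?adde0; last first.
    by move=> i; rewrite add0n /A_ ltnNge => ->.
  rewrite add0n (big_nth [::]) -sumEFin big_nat [RHS]big_nat.
  by apply: eq_bigr => i /andP[_ il]; rewrite /A_ il.
(* This allows an extra [e / 2 ^ i.+1] at index [i]. The padding word there has length [p + i.+1],
   and [2 ^- p <= e]. *)
apply: le_trans (epsilon_trick _ A0 (ltW e0)).
apply: (@le_trans _ _ (\sum_(0 <= i <oo) cyl_weight R (t i))%E).
  apply: ereal_inf_lbound; exists t => // y /Al[s sl sy].
  by exists (index s l) => //; rewrite /t index_mem sl nth_index.
apply: lee_nneseries => [i _ _|i _]; first exact: cyl_weight_ge0.
rewrite /t /A_; case: ifP => _; first by rewrite leeDl// lee_fin divr_ge0// ltW.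
by rewrite add0e lee_fin size_nseq exprD invfM natrX ler_pM2r.
Qed.

(** The cylinders of length [n] that meet [K] cover it. *)
Lemma mu_le_freq K n : (mu R K <= (freq R n (hits K))%:E)%E.
Proof.
rewrite freqE -big_filter; apply: mu_finite_cover => y Ky.
exists (restr y n); last exact: cyl_restr.
rewrite mem_filter mem_words ?size_mkseq// andbT.
by apply/asboolP; exists y; split=> //; exact: cyl_restr.
Qed.

(** Compactness leaves finitely many cylinders, and [n] is taken at least as large as their lengths.
    Together with [mu_le_freq] this makes the measure of [K] the infimum of its hitting
    frequencies. *)
Lemma freq_le_cover K (s : nat -> seq bool) : compact K ->
  K `<=` \bigcup_i cyl (s i) ->
  \forall n \near \oo,
    ((freq R n (hits K))%:E <= \sum_(0 <= i <oo) cyl_weight R (s i))%E.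
Proof.
move=> /compact_near_coveringP cK Ks.
have [|m _ mP] := cK nat \oo
  (fun m y => exists2 i, (i < m)%N & cyl (s i) y) _.
  move=> y /Ks[i _ iy].
  exists (cyl (s i), [set m | (i < m)%N]).
    by split; [apply: open_nbhs_nbhs; split=> //; exact: open_cyl|exists i.+1].
  by move=> [w m] /= [wi im]; exists i.
exists (\max_(i < m) size (s i))%N => // n /= mn.
apply: le_trans (nneseries_lim_ge m _); last by move=> i _ _; exact: cyl_weight_ge0.
rewrite sumEFin lee_fin.
(* Each word [t] of length [n] that [K] hits extends some [s i] with [i < m], so its indicator is at
   most the sum of the indicators of these prefixes. *)
apply: (@le_trans _ _ (\sum_(0 <= i < m) freq R n (prefix (s i)))).
  rewrite /freq -avg_sum; apply: le_avg => t tn.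
  rewrite /hits; case: asboolP => [[y [Ky ty]]|_]; last by rewrite sumr_ge0.
  have [i im iy] := mP m (leqnn m) y Ky.
  rewrite (bigD1_seq i) ?mem_index_iota ?iota_uniq//=.
  rewrite (_ : prefix (s i) t) ?lerDl ?sumr_ge0//.
  move/cylP : ty => <-; rewrite tn; apply/prefix_restr => //.
  by apply: leq_trans mn; exact: (leq_bigmax (Ordinal im)).
rewrite big_nat [leRHS]big_nat; apply: ler_sum => i /andP[_ im].
by rewrite freq_prefix1//; apply: leq_trans mn; exact: (leq_bigmax (Ordinal im)).
Qed.

Lemma mu_lt_near K (r : R) : compact K -> (mu R K < r%:E)%E ->
  \forall n \near \oo, freq R n (hits K) < r.
Proof.
move=> cK /ereal_inf_lt[_ [s Ks <-] sr].
apply: filterS (freq_le_cover _ _ cK Ks) => n ns.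
by rewrite -lte_fin; exact: le_lt_trans ns sr.
Qed.

Lemma hits_cyl K u s : (size u <= size s)%N ->
  hits (K `&` cyl u) s = prefix u s && hits K s.
Proof.
move=> us; apply/asboolP/andP.
  move=> [y [[Ky uy] sy]]; split; last by apply/asboolP; exists y.
  by move/cylP : (sy) => <-; apply/prefix_restr.
move=> [pus /asboolP[y [Ky sy]]]; exists y; split => //; split=> //.
by move/cylP : (sy) pus => {1}<- /prefix_restr; apply.
Qed.

(** An infimum is below [r] iff one of its terms is. At level [n + j] only the words extending
    [restr z n] count, whence the factor [2 ^- n]. All complexity bounds rest on this finitary
    form. *)
Lemma muKN_ltP (K : hyperspace) (z : cantor_space) n (r : R) :
  (muKN R K z n < r%:E)%E <->
  exists j, 2 ^- n * freq R j (fun s => hits (sval K) (restr z n ++ s)) < r.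
Proof.
have sz : size (restr z n) = n by rewrite size_mkseq.
have E j : freq R (n + j) (hits (sval K `&` cyl (restr z n))) =
    2 ^- n * freq R j (fun s => hits (sval K) (restr z n ++ s)).
  have := freq_prefix R (restr z n) j (hits (sval K)).
  rewrite sz => <-; apply: eq_freq => s sn.
  by rewrite hits_cyl// sz sn leq_addr.
have cK : compact (sval K `&` cyl (restr z n)).
  by apply: compact_closedI; [exact: (svalP K)|exact: closed_cyl].
split=> [/(mu_lt_near _ _ cK)[N _ NP]|[j]].
  by exists N; rewrite -E; apply: NP; exact: leq_addl.
by rewrite -E -lte_fin; exact: le_lt_trans (mu_le_freq _ _).
Qed.

Lemma mu_cyl u : mu R (cyl u) = (2 ^- size u)%:E.
Proof.
apply/eqP; rewrite eq_le; apply/andP; split.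
  have := @mu_finite_cover (cyl u) [:: u]; rewrite big_seq1; apply.
  by move=> y uy; exists u; rewrite ?inE.
rewrite leNgt; apply/negP => /(mu_lt_near _ _ (compact_closed_cantor _ (closed_cyl u))).
case=> N _ NP; have := NP (maxn N (size u)) (leq_maxl _ _).
rewrite (_ : freq _ _ _ = 2 ^- size u) ?ltxx//.
rewrite -(freq_prefix1 R u _ (leq_maxr N _)); apply: eq_freq => s sn.
rewrite -[cyl u]setTI hits_cyl ?sn ?leq_maxr// andbC (_ : hits _ _ = true)//.
apply/asboolP; exists (nth false s); split => // i; exact.
Qed.

Lemma muKN_fin_num (K : hyperspace) (z : cantor_space) n :
  muKN R K z n \is a fin_num.
Proof.
rewrite ge0_fin_numE ?mu_ge0//.
by apply: le_lt_trans (mu_le_freq _ 0) _; rewrite ltry.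
Qed.

(** The factor [2 ^- n] of [muKN_ltP] cancels against the measure of the cylinder. *)
Lemma dens_ratio_ltP (K : hyperspace) (z : cantor_space) n (r : R) :
  (dens_ratio R K z n < r%:E)%E <->
  exists j, freq R j (fun s => hits (sval K) (restr z n ++ s)) < r.
Proof.
have n0 : 0 < 2 ^- n :> R by rewrite invr_gt0 exprn_gt0.
rewrite /dens_ratio mu_cyl size_mkseq lte_fin /= ltr_pdivrMr// mulrC.
rewrite -lte_fin fineK ?muKN_fin_num// muKN_ltP.
by split=> -[j]; rewrite ?ltr_pM2l// => jr; exists j; rewrite ?ltr_pM2l.
Qed.

End Measure.

(** * Upper bounds on complexity *)

Lemma open_vietoris p : open p.1 -> open (vietoris_subbase p).
Proof.
move=> op; exists [set vietoris_subbase p]; last by rewrite bigcup_set1.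
by move=> _ ->; exact: finI_from1.
Qed.

Lemma nbhs_vietoris {T : Type} (F : set_system T) (f : T -> hyperspace)
    (K : hyperspace) : Filter F ->
  (forall p, open p.1 -> vietoris_subbase p K ->
     F (f @^-1` vietoris_subbase p)) -> f @ F --> K.
Proof.
move=> FF Fp A; rewrite nbhsE => -[B [[C CD <-] [D CDD DK]] BA].
rewrite nbhs_filterE; apply: (@filterS _ F FF (f @^-1` D)).
  by move=> z Dz; apply: BA; exists D.
have [E ED DE] := CD _ CDD; move: DK; rewrite -DE => DK.
rewrite preimage_bigcap; apply: filter_bigI => p pE.
by apply: Fp; [have := ED _ pE; rewrite inE|exact: DK].
Qed.

(** As cylinders are clopen, meeting one and missing one are both subbasic open conditions on
    [K]. *)
Lemma loc_cst_hits s : loc_cst (fun K : hyperspace => hits (sval K) s).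
Proof.
apply: loc_cst_bool; split.
  rewrite (_ : mkset _ = vietoris_subbase (cyl s, false)).
    by apply: open_vietoris; exact: open_cyl.
  by apply/seteqP; split=> K /asboolP.
rewrite -openC (_ : ~` _ = vietoris_subbase (~` cyl s, true)).
  by apply: open_vietoris; apply: closed_openC; exact: closed_cyl.
apply/seteqP; split=> K /=.
  by move=> Ks y Ky sy; apply: Ks; apply/asboolP; exists y.
by move=> Ks /asboolP[y [/Ks]].
Qed.

Lemma loc_cst_continuous {S T : topologicalType} {A : Type} (f : T -> A)
  (g : S -> T) : loc_cst f -> continuous g -> loc_cst (f \o g).
Proof. by move=> fl gc z; exact: (gc z _ (fl (g z))). Qed.

Lemma fst_continuous {S T : topologicalType} : continuous (@fst S T).
Proof. by move=> z; exact: cvg_fst. Qed.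

Lemma snd_continuous {S T : topologicalType} : continuous (@snd S T).
Proof. by move=> z; exact: cvg_snd. Qed.

Section UpperBounds.
Variable R : realType.

Definition density (K : hyperspace) (u : seq bool) (j : nat) : R :=
  freq R j (fun s => hits (sval K) (u ++ s)).

Lemma loc_cst_nat : loc_cst (@id nat).
Proof. move=> n; exact: (discrete_set1 n). Qed.

Lemma loc_cst_density n j :
  loc_cst (fun p : hyperspace * cantor_space => density p.1 (restr p.2 n) j).
Proof.
move=> [K z].
have zl := loc_cst_continuous _ _ (loc_cst_restr n)
  (@snd_continuous hyperspace cantor_space) (K, z).
have wl := near_seq (fun (p : hyperspace * cantor_space) s =>
  hits (sval p.1) (restr z n ++ s)) (words j) _ (K, z).
apply: filterS2 zl (wl _) => [[L w] /= -> Ls|s].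
  by apply: eq_freq => s /mem_words; exact: Ls.
apply: (loc_cst_continuous _ _ (loc_cst_hits (restr z n ++ s))).
exact: fst_continuous.
Qed.

Definition approx_mu (j : nat) (p : hyperspace * cantor_space * nat) : R :=
  2 ^- p.2 * density p.1.1 (restr p.1.2 p.2) j.

Lemma loc_cst_approx_mu j : loc_cst (approx_mu j).
Proof.
move=> [[K z] n].
have nl := loc_cst_continuous _ _ loc_cst_nat
  (@snd_continuous (hyperspace * cantor_space)%type nat) (K, z, n).
have dl := loc_cst_continuous _ _ (loc_cst_density n j)
  (@fst_continuous (hyperspace * cantor_space)%type nat) (K, z, n).
by apply: filterS2 nl dl => -[[L w] m] /= -> ; rewrite /approx_mu /= => ->.
Qed.

Lemma continuous_sval : continuous (fun r : I01 R => sval r : R).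
Proof. exact: initial_continuous. Qed.

Lemma open_lt_loc_cst {T : topologicalType} (g : T -> R) (r : T -> I01 R) (c : R) :
  loc_cst g -> continuous r -> open [set z | g z < sval (r z) + c].
Proof.
move=> gl rc; rewrite openE => z /= gz.
have rz : \forall w \near z, g z < sval (r w) + c.
  have /cvgr_gt : (fun w => sval (r w) + c) @ z --> sval (r z) + c.
    apply: cvgD; last exact: cvg_cst.
    by apply: (@continuous_comp _ _ _ r _ z); [exact: rc|exact: continuous_sval].
  by apply.
by apply: filterS2 (gl z) rz => w /= ->.
Qed.

Lemma closed_le_loc_cst {T : topologicalType} (g : T -> R) (r : T -> I01 R) (c : R) :
  loc_cst g -> continuous r -> closed [set z | g z <= sval (r z) + c].
Proof.
move=> gl rc; rewrite -openC openE => z /= /negP; rewrite -ltNge => gz.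
have rz : \forall w \near z, sval (r w) + c < g z.
  have /cvgr_lt : (fun w => sval (r w) + c) @ z --> sval (r z) + c.
    apply: cvgD; last exact: cvg_cst.
    by apply: (@continuous_comp _ _ _ r _ z); [exact: rc|exact: continuous_sval].
  by apply.
by apply: filterS2 (gl z) rz => w /= -> ?; apply/negP; rewrite -ltNge.
Qed.

Lemma closed_ge_loc_cst {T : topologicalType} (g : T -> R) (r : T -> I01 R) (c : R) :
  loc_cst g -> continuous r -> closed [set z | sval (r z) + c <= g z].
Proof.
move=> gl rc; rewrite -openC.
rewrite (_ : ~` _ = [set z | g z < sval (r z) + c]).
  exact: open_lt_loc_cst.
by apply/seteqP; split=> z /=; rewrite ltNge => /negP.
Qed.

Lemma Pi2_preimage {S T : topologicalType} (f : S -> T) (A : set T) :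
  continuous f -> Pi0 2 A -> Pi0 2 (f @^-1` A).
Proof.
move=> fc [F [Fo AF]]; exists (fun i => f @^-1` F i); split=> [i|].
  rewrite -[~` _]/(f @^-1` (~` F i)).
  by move/continuousP : fc; apply; exact: Fo.
by rewrite preimage_setC AF preimage_bigcup.
Qed.

Lemma closed_Sigma2 {T : topologicalType} (A : set T) : closed A -> Sigma0 2 A.
Proof.
move=> cA; exists (fun=> A); split; first by move=> _; exact: closed_openC.
by apply/seteqP; split=> [z Az|z [_ _]]; first by exists 0%N.
Qed.

Lemma Sigma2_bigcup {T : topologicalType} (A : nat -> set T) :
  (forall i, Sigma0 2 (A i)) -> Sigma0 2 (\bigcup_i A i).
Proof.
move=> /choice[F FA].
exists (fun k => F (Cantor.of_nat k).1 (Cantor.of_nat k).2); split.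
  by move=> k; have [+ _] := FA (Cantor.of_nat k).1; apply.
apply/seteqP; split=> z.
  move=> [i _]; have [_ ->] := FA i => -[j _ ijz].
  by exists (Cantor.to_nat (i, j)) => //; rewrite Cantor.cancel_of_to.
move=> [k _ kz]; exists (Cantor.of_nat k).1 => //.
by have [_ ->] := FA (Cantor.of_nat k).1; exists (Cantor.of_nat k).2.
Qed.

Lemma Sigma2U {T : topologicalType} (A B : set T) :
  Sigma0 2 A -> Sigma0 2 B -> Sigma0 2 (A `|` B).
Proof.
move=> sA sB; rewrite (_ : _ `|` _ = \bigcup_i (if i == 0%N then A else B)).
  by apply: Sigma2_bigcup => i; case: ifP.
apply/seteqP; split=> [z [Az|Bz]|z [i _]]; [by exists 0%N|by exists 1%N|].
by case: ifP => _; [left|right].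
Qed.

(** This turns a strict inequality into a countable union of non-strict ones, which will define
    closed sets. *)
Lemma lte_addr_invP (r : R) (x : \bar R) :
  (r%:E < x)%E <-> exists k, ((r + k.+1%:R^-1)%:E <= x)%E.
Proof.
split=> [|[k]]; last by apply: lt_le_trans; rewrite lte_fin ltrDl invr_gt0.
case: x => [x| |]//; last by exists 0%N; rewrite leey.
by rewrite lte_fin => /ltr_add_invr[k /ltW kx]; exists k.
Qed.

Lemma lte_subr_invP (r : R) (x : \bar R) :
  (x < r%:E)%E <-> exists k, (x <= (r - k.+1%:R^-1)%:E)%E.
Proof.
split=> [|[k]]; last first.
  by move/le_lt_trans; apply; rewrite lte_fin ltrBlDr ltrDl invr_gt0.
case: x => [x| |]//; last by exists 0%N; rewrite leNye.
by rewrite lte_fin => /ltr_add_invr[k /ltW kx]; exists k; rewrite lee_fin lerBrDr.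
Qed.

(** The measure exceeds [r] iff, for some [k], all its finite-level approximations are at least
    [r + k.+1%:R^-1]; for fixed [k] this is a closed condition. *)
Lemma Sigma2_A_gt : Sigma0 2 (A_gt R).
Proof.
rewrite (_ : A_gt R = \bigcup_k \bigcap_j
    [set p | sval p.2 + k.+1%:R^-1 <= approx_mu j p.1]).
  apply: Sigma2_bigcup => k; apply: closed_Sigma2; apply: closed_bigI => j _.
  apply: (closed_ge_loc_cst (approx_mu j \o fst)); last exact: snd_continuous.
  apply: loc_cst_continuous; [exact: loc_cst_approx_mu|exact: fst_continuous].
apply/seteqP; split=> [[[[K z] n] r]|[[[K z] n] r]].
  move=> /lte_addr_invP[k kr]; exists k => // j _.
  rewrite /= leNgt; apply/negP => h; move: kr; apply/negP; rewrite -ltNge.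
  by apply/muKN_ltP; exists j.
move=> [k _ kP]; apply/lte_addr_invP; exists k; rewrite leNgt; apply/negP.
by move=> /muKN_ltP[j]; apply/negP; rewrite -leNgt; exact: kP.
Qed.

Lemma Sigma2_A_lt : Sigma0 2
  [set p : hyperspace * cantor_space * nat * I01 R |
    (muKN R p.1.1.1 p.1.1.2 p.1.2 < (sval p.2)%:E)%E].
Proof.
rewrite (_ : mkset _ = \bigcup_j \bigcup_k
    [set p | approx_mu j p.1 <= sval p.2 - k.+1%:R^-1]).
  apply: Sigma2_bigcup => j; apply: Sigma2_bigcup => k; apply: closed_Sigma2.
  apply: (closed_le_loc_cst (approx_mu j \o fst)); last exact: snd_continuous.
  apply: loc_cst_continuous; [exact: loc_cst_approx_mu|exact: fst_continuous].
apply/seteqP; split=> [[[[K z] n] r] /muKN_ltP[j jr]|[[[K z] n] r] [j _ [k _ jk]]].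
  have /lte_subr_invP[k] : ((approx_mu j (K, z, n))%:E < (sval r)%:E)%E by [].
  by rewrite lee_fin => kr; exists j => //; exists k.
by apply/muKN_ltP; exists j; apply: le_lt_trans jk _; rewrite ltrBlDr ltrDl invr_gt0.
Qed.

Lemma setC_A_le : ~` A_le R = A_gt R.
Proof. by apply/seteqP; split=> p; rewrite /A_gt /= ltNge => /negP. Qed.

Lemma Pi2_A_le : Pi0 2 (A_le R).
Proof.
by rewrite /Pi0 /= setC_A_le; exact: Sigma2_A_gt.
Qed.

Lemma Pi2_A_eq : Pi0 2 (A_eq R).
Proof.
have := Sigma2U _ _ Sigma2_A_gt Sigma2_A_lt; rewrite /Pi0 /=.
set U := _ `|` _; rewrite (_ : ~` _ = U)//.
apply/seteqP; split=> p /= => [/eqP|[]]; last 2 first.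
- by move=> + pE; rewrite /A_gt /= pE ltxx.
- by move=> + pE; rewrite /A_gt /= pE ltxx.
by rewrite neq_lt => /orP[]; [right|left].
Qed.

(** The lower limit is the supremum of the infima of the tails, so it exceeds [r] iff some tail
    stays above [r] by a fixed margin. *)
Lemma lt_limn_einfP (u : (\bar R)^nat) (r : R) : (r%:E < limn_einf u)%E <->
  exists k N, forall n, (N <= n)%N -> ((r + k.+1%:R^-1)%:E <= u n)%E.
Proof.
have -> : limn_einf u = ereal_sup (range (einfs u)).
  rewrite limn_einf_lim; apply/cvg_lim => //; exact: cvg_einfs_sup.
split=> [/ereal_sup_gt[_ [N _ <-] /lte_addr_invP[k kN]]|[k [N Nk]]].
  by exists k, N => n Nn; apply: le_trans kN _; apply: ereal_inf_lbound; exists n.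
apply/lte_addr_invP; exists k.
apply: (@le_trans _ _ (einfs u N)); last by apply: ereal_sup_ubound; exists N.
by apply: le_ereal_inf_tmp => _ [n /= Nn <-]; exact: Nk.
Qed.

(** The shift [c] is 0 for [Bm_gt] and [- k.+1%:R^-1] for [Bm_lt]. *)
Lemma Sigma2_Dminus (c : R) : Sigma0 2
  [set p : hyperspace * cantor_space * I01 R |
    ((sval p.2 + c)%:E < Dminus R p.1.1 p.1.2)%E].
Proof.
rewrite (_ : mkset _ = \bigcup_k \bigcup_N \bigcap_(n in [set n | (N <= n)%N])
    \bigcap_j [set p | sval p.2 + (c + k.+1%:R^-1) <=
      density p.1.1 (restr p.1.2 n) j]).
  apply: Sigma2_bigcup => k; apply: Sigma2_bigcup => N; apply: closed_Sigma2.
  apply: closed_bigI => n _; apply: closed_bigI => j _.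
  pose g (p : hyperspace * cantor_space) := density p.1 (restr p.2 n) j.
  apply: (closed_ge_loc_cst (g \o fst)); last exact: snd_continuous.
  apply: loc_cst_continuous; [exact: loc_cst_density|exact: fst_continuous].
apply/seteqP; split=> [[[K z] r] /lt_limn_einfP[k [N kN]]|[[K z] r] [k _ [N _ kN]]].
  exists k => //; exists N => // n /kN kn j _ /=.
  rewrite leNgt addrA; apply/negP => h; move: kn; apply/negP; rewrite -ltNge.
  by apply/dens_ratio_ltP; exists j.
apply/lt_limn_einfP; exists k, N => n Nn; rewrite leNgt; apply/negP.
move=> /dens_ratio_ltP[j]; apply/negP; rewrite -leNgt -addrA.
exact: (kN n Nn j).
Qed.

Lemma Sigma2_Bm_gt : Sigma0 2 (Bm_gt R).
Proof.
have := Sigma2_Dminus 0; congr (Sigma0 2 _).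
by apply/seteqP; split=> p /=; rewrite addr0.
Qed.

Lemma setC_Bm_le : ~` Bm_le R = Bm_gt R.
Proof. by apply/seteqP; split=> p; rewrite /Bm_gt /= ltNge => /negP. Qed.

Lemma Pi2_Bm_le : Pi0 2 (Bm_le R).
Proof.
by rewrite /Pi0 /= setC_Bm_le; exact: Sigma2_Bm_gt.
Qed.

Lemma Sigma3_Bm_lt : Sigma0 3 (Bm_lt R).
Proof.
exists (fun k => ~` [set p : hyperspace * cantor_space * I01 R |
    ((sval p.2 - k.+1%:R^-1)%:E < Dminus R p.1.1 p.1.2)%E]); split.
  by move=> k; rewrite setCK; exact: Sigma2_Dminus.
apply/seteqP; split=> [p /lte_subr_invP[k pk]|p [k _ /negP]].
  by exists k => //; apply/negP; rewrite -leNgt.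
by rewrite -leNgt => pk; apply/lte_subr_invP; exists k.
Qed.

Lemma setC_Bm_ge : ~` Bm_ge R = Bm_lt R.
Proof. by apply/seteqP; split=> p; rewrite /Bm_lt /= ltNge => /negP. Qed.

Lemma Pi3_Bm_ge : Pi0 3 (Bm_ge R).
Proof.
by rewrite /Pi0 /= setC_Bm_ge; exact: Sigma3_Bm_lt.
Qed.

End UpperBounds.

(** * Sets given by trees *)

Section TreeBody.

(** These are the nonempty pruned trees; having no dead ends makes each of their words an initial
    segment of a point of the body. *)
Definition is_tree (T : pred (seq bool)) :=
  [/\ T [::], (forall s b, T (rcons s b) -> T s) &
      (forall s, T s -> exists b, T (rcons s b))].

Definition body (T : pred (seq bool)) : set cantor_space :=
  [set y | forall n, T (restr y n)].

Lemma compact_body T : compact (body T).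
Proof.
apply: compact_closed_cantor.
rewrite (_ : body T = \bigcap_n [set y | T (restr y n)]).
  apply: closed_bigI => n _.
  exact: (closed_loc_cst _ (fun s => T s) (loc_cst_restr n)).
by apply/seteqP; split=> y yT n; [move=> _|]; exact: yT.
Qed.

Definition tree_body T : hyperspace := exist _ (body T) (compact_body T).

Lemma tree_prefix T s t : is_tree T -> T (s ++ t) -> T s.
Proof.
move=> [_ Tr _]; elim/last_ind: t => [|t b IH]; first by rewrite cats0.
by rewrite -rcons_cat => /Tr.
Qed.

Lemma hits_body T s : is_tree T -> hits (body T) s = T s.
Proof.
move=> tT; apply/asboolP/idP => [[y [yT /cylP <-]]|Ts]; first exact: yT.
(* The leftmost branch through [s]: append 0 if this stays in the tree, otherwise 1, which then
   stays in it by pruning. *)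
pose t n := iter n (fun s => rcons s (~~ T (rcons s false))) s.
have Tt n : T (t n).
  elim: n => //= n IH; case h : (T (rcons (t n) false)) => //=.
  by have [_ _ /(_ _ IH)[[]]] := tT; rewrite ?h.
have size_t n : size (t n) = (size s + n)%N.
  by elim: n => [|n IH]; rewrite ?addn0//= size_rcons IH addnS.
have nth_t k j i : (i < size (t k))%N ->
    nth false (t (k + j)%N) i = nth false (t k) i.
  move=> ik; elim: j => [|j IH]; first by rewrite addn0.
  rewrite addnS /= nth_rcons (leq_trans ik) ?IH// !size_t.
  by rewrite leq_add2l leq_addr.
have lt_t i : (i < size (t i.+1))%N by rewrite size_t addnS ltnS leq_addl.
(* The word [t i.+1] is the first sure to have a letter at place [i], even for empty [s]. *)
exists (fun i => nth false (t i.+1) i); split=> [n|i im]; last first.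
  by rewrite -(nth_t 0%N i.+1).
apply: (tree_prefix _ _ (drop n (t n)) tT).
rewrite (_ : restr _ n = take n (t n)) ?cat_take_drop//.
apply: (@eq_from_nth _ false); rewrite size_mkseq.
  by rewrite size_takel// size_t leq_addl.
move=> i im; rewrite nth_mkseq// nth_take//.
by rewrite -(subnKC im) nth_t.
Qed.

(** Inclusion of the body in an open set is secured by the words of one level, by [compact_level],
    and meeting an open set by a single word. Both are thus preserved near [z]. *)
Lemma continuous_tree_body {Z : topologicalType} (T : Z -> pred (seq bool)) :
  (forall z, is_tree (T z)) -> (forall s, loc_cst (fun z => T z s)) ->
  continuous (fun z => tree_body (T z)).
Proof.
move=> tT Tl z; apply: nbhs_vietoris => -[U []] /= oU.
  move=> zU.
  have [n nU] := compact_level _ _ (compact_body (T z)) oU zU.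
  apply: filterS (near_seq _ (words n) Tl z) => w wz y /(_ n).
  rewrite (wz (restr y n)) ?mem_words ?size_mkseq// -hits_body//.
  move=> /asboolP[y' [y'z /cylP]]; rewrite size_mkseq => e.
  exact: (nU y').
move=> [y [yz Uy]].
have [|n nU] := @nbhs_cantor y U; first exact: open_nbhs_nbhs.
apply: filterS (Tl (restr y n) z) => w; rewrite (yz n) -hits_body//.
move=> /asboolP[y' [y'w /cylP]]; rewrite size_mkseq => e.
by exists y'; split=> //; exact: nU.
Qed.

End TreeBody.

(** * Sets in zero-dimensional Polish spaces as conditions on sequences of bits *)

Section Reductions.
Variable R : realType.

Lemma open_bigcup_clopen (Z : topologicalType) : polish R Z -> zero_dim Z ->
  forall U : set Z, open U ->
  exists C : nat -> set Z, (forall i, clopen (C i)) /\ U = \bigcup_i C i.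
Proof.
move=> [[D [/countable_injP[h hinj] Dd]] [d [d0 dC dt dopen _]]] zd U oU.
pose inner_ball a k V := clopen V /\ [set y : Z | d a y < k.+1%:R^-1] `<=` V.
(* Countability comes from the balls with centre in the dense set and radius [k.+1%:R^-1]: for each
   of them one clopen subset of [U] containing it is chosen, if there is any. *)
have /choice[C CP] : forall p : nat * nat, exists V : set Z,
    [/\ clopen V, V `<=` U & forall a, D a -> h a = p.1 ->
      (exists2 V', inner_ball a p.2 V' & V' `<=` U) ->
      [set y : Z | d a y < p.2.+1%:R^-1] `<=` V].
  move=> [i k].
  have [[a [V [Da ai [cV aV] VU]]]|no] := pselect (exists a V,
      [/\ D a, h a = i, inner_ball a k V & V `<=` U]).
    exists V; split=> // b Db bi _.
    by rewrite (_ : b = a)//; apply: hinj; rewrite ?inE// ai.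
  exists set0; split=> [||a Da ai [V aV VU]]; [exact: clopen0|by []|].
  by exfalso; apply: no; exists a, V.
exists (C \o Cantor.of_nat); split=> [i|]; first by have [] := CP (Cantor.of_nat i).
apply/seteqP; split=> [z Uz|z [i _ iz]]; last first.
  by have [_ + _] := CP (Cantor.of_nat i); apply.
have [V [cV Vz VU]] := zd U z oU Uz.
have [e e0 eV] := (dopen V).1 cV.1 z Vz.
have [k] := ltr_add_invr e0; rewrite add0r => ke.
(* The radius is half of [k.+1%:R^-1], so the ball of this radius around a nearby [a] contains [z]
   and stays in the [e]-ball around [z], hence in [V]. *)
have [] := Dd [set y | d z y < (k.*2.+1).+1%:R^-1].
- by exists z => /=; rewrite (d0 z z).2.
- apply/dopen => x /= zx; exists ((k.*2.+1).+1%:R^-1 - d z x); rewrite ?subr_gt0//.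
  by move=> y /= xy; apply: le_lt_trans (dt z x y) _; rewrite -ltrBrDl.
move=> a [/= za Da].
exists (Cantor.to_nat (h a, k.*2.+1)) => //.
rewrite /comp Cantor.cancel_of_to.
have [_ _ /(_ a Da erefl)] := CP (h a, k.*2.+1); apply; last by rewrite /= dC.
exists V => //; split=> // y /= ay; apply: eV => /=.
apply: le_lt_trans (dt z a y) _; apply: lt_trans ke.
apply: lt_le_trans (ltrD za ay) _.
by rewrite -doubleS -muln2 natrM invfM -splitr.
Qed.

Lemma loc_cst_all {Z : topologicalType} (p : Z -> nat -> bool) (l : seq nat) :
  (forall i, loc_cst (fun z => p z i)) -> loc_cst (fun z => all (p z) l).
Proof. by move=> pl z; apply: filterS (near_seq _ l pl z) => w /eq_in_all. Qed.

Lemma loc_cst_has {Z : topologicalType} (p : Z -> nat -> bool) (l : seq nat) :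
  (forall i, loc_cst (fun z => p z i)) -> loc_cst (fun z => has (p z) l).
Proof. by move=> pl z; apply: filterS (near_seq _ l pl z) => w /eq_in_has. Qed.

Let row k := (Cantor.of_nat k).1.
Let col k := (Cantor.of_nat k).2.

Let rowE i j : row (Cantor.to_nat (i, j)) = i.
Proof. by rewrite /row Cantor.cancel_of_to. Qed.

Let colE i j : col (Cantor.to_nat (i, j)) = j.
Proof. by rewrite /col Cantor.cancel_of_to. Qed.

Let row_colK k : Cantor.to_nat (row k, col k) = k.
Proof. by rewrite /row /col -surjective_pairing Cantor.cancel_to_of. Qed.

Let leq_to_nat i j :
  (i <= Cantor.to_nat (i, j))%N /\ (j <= Cantor.to_nat (i, j))%N.
Proof. by have /ssrnat.leP := Cantor.to_nat_non_decreasing i j; lia. Qed.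

(* Row i of x z has a one, and then exactly one, iff z belongs to the first i + 1
   of the open sets whose intersection is B. *)
Lemma Pi2_reduction (Z : topologicalType) (B : set Z) :
  polish R Z -> zero_dim Z -> Pi0 2 B ->
  exists x : Z -> nat -> bool, (forall i, loc_cst (fun z => x z i)) /\
    forall z, B z <-> forall N, exists2 k, (N <= k)%N & x z k.
Proof.
move=> pZ zZ [F [Fo BF]].
have /choice[C CP] i := open_bigcup_clopen _ pZ zZ _ (Fo i).
pose c z i j := `[< C i j z >].
(* At stage [j], the point [z] has been found in a clopen piece of each of the first [i + 1] open
   sets. The one in row [i] marks the first such stage. *)
pose e z i j := all (fun i' => has (c z i') (iota 0 j.+1)) (iota 0 i.+1).
pose x z k := e z (row k) (col k) && ~~ has (e z (row k)) (iota 0 (col k)).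
have cl i j : loc_cst (fun z => c z i j).
  apply: loc_cst_bool; rewrite (_ : mkset _ = C i j); first exact: (CP i).1.
  by apply/seteqP; split=> z /asboolP.
have el i j : loc_cst (fun z => e z i j).
  by apply: loc_cst_all => i'; apply: loc_cst_has => j'; exact: cl.
have BE z : B z <-> forall i, exists j, c z i j.
  transitivity (forall i, (~` F i) z).
    split=> [Bz i Fz|Fz]; last first.
      apply: contrapT => nB; have : (~` B) z by [].
      by rewrite BF => -[i _]; exact: Fz.
    by have : (~` B) z; [rewrite BF; exists i|apply].
  split=> Fz i; have := Fz i; rewrite (CP i).2.
    by move=> [j _ jz]; exists j; apply/asboolP.
  by move=> [j /asboolP jz]; exists j.
exists x; split=> [k|z].
  apply: (loc_cst2 (fun a b => a && ~~ b)); first exact: el.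
  by apply: loc_cst_has; exact: el.
split=> [/BE/choice[J JP] N|inf].
  have [|j jP jmin] := @ex_minnP (e z N).
    exists (\max_(i < N.+1) J i)%N; apply/allP => i.
    rewrite mem_iota add0n => /andP[_ iN].
    apply/hasP; exists (J i); last exact: JP.
    by rewrite mem_iota add0n ltnS; exact: (leq_bigmax (Ordinal iN)).
  exists (Cantor.to_nat (N, j)); first exact: (leq_to_nat _ _).1.
  rewrite /x rowE colE jP; apply/hasPn => j'; rewrite mem_iota add0n /= => jj'.
  by apply/negP => /jmin; rewrite leqNgt jj'.
have x_inj k k' : x z k -> x z k' -> row k = row k' -> k = k'.
  wlog : k k' / (col k <= col k')%N.
    move=> W xk xk' rk; have [/W|/ltnW /W] := leqP (col k) (col k'); first exact.
    by move=> <-.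
  rewrite leq_eqVlt => /orP[/eqP ck|ck] /andP[ek _] /andP[_ /hasPn nk'] rk.
    by rewrite -(row_colK k) -(row_colK k') ck rk.
  by have := nk' (col k); rewrite mem_iota add0n ck -rk ek => /(_ isT).
(* With at most one one in each row, infinitely many ones must reach arbitrarily high rows. *)
have rows i : exists N, forall k, (N <= k)%N -> x z k -> (i <= row k)%N.
  elim: i => [|i [N NP]]; first by exists 0%N.
  have [[k0 [xk0 rk0]]|no] := pselect (exists k0, x z k0 /\ row k0 = i).
    exists (maxn N k0.+1) => k; rewrite geq_max => /andP[/NP rk k0k] xk.
    rewrite ltn_neqAle rk// andbT; apply/negP => /eqP ik.
    by move: k0k; rewrite (x_inj k k0) ?ltnn// rk0.
  exists N => k /NP rk xk; rewrite ltn_neqAle rk// andbT.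
  by apply/negP => /eqP ik; apply: no; exists k.
apply/BE => i; have [N NP] := rows i; have [k /NP Nk xk] := inf N.
have ik : i \in iota 0 (row k).+1 by rewrite mem_iota add0n ltnS Nk.
by move: xk => /andP[/allP/(_ i ik)/hasP[j _ ij] _]; exists j.
Qed.

Lemma Pi3_reduction (Z : topologicalType) (B : set Z) :
  polish R Z -> zero_dim Z -> Pi0 3 B ->
  exists (x : Z -> nat -> bool) (m : nat -> nat),
    (forall i, loc_cst (fun z => x z i)) /\
    forall z, B z <->
      forall M, exists N, forall k, (N <= k)%N -> x z k -> (M <= m k)%N.
Proof.
move=> pZ zZ [F [Fs BF]].
have /choice[X XP] i := Pi2_reduction _ _ pZ zZ (Fs i).
have BE z : B z <-> forall i, ~ F i z.
  split=> [Bz i Fz|Fz].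
    by have : (~` B) z; [rewrite BF; exists i|apply].
  apply: contrapT => nB; have : (~` B) z by [].
  by rewrite BF => -[i _]; exact: Fz.
exists (fun z k => X (row k) z (col k)), row; split=> [k|z].
  by have [+ _] := XP (row k); apply.
split=> [/BE nF M|fin].
  elim: M => [|M [N NP]]; first by exists 0%N.
  have [N0 N0P] : exists N0, forall n, (N0 <= n)%N -> ~~ X M z n.
    apply: contrapT => no; apply: (nF M); apply/(XP M).2 => N1.
    apply: contrapT => no1; apply: no; exists N1 => n nN1.
    by apply/negP => xn; apply: no1; exists n.
  (* Beyond [N] there are no ones in rows below [M]; the second bound passes the places of row [M]
     in columns below [N0], which hold all its ones. *)
  exists (maxn N (\max_(n < N0) (Cantor.to_nat (M, n : nat)).+1))%N => k.
  rewrite geq_max => /andP[/NP rk kN0] xk; rewrite ltn_neqAle rk// andbT.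
  apply/negP => /eqP Mk; rewrite -Mk in xk.
  have cN0 : (col k < N0)%N.
    by rewrite ltnNge; apply/negP => /N0P; rewrite xk.
  have : (Cantor.to_nat (M, col k) < k)%N.
    by apply: leq_trans kN0; exact: (leq_bigmax (Ordinal cN0)).
  by rewrite Mk row_colK ltnn.
apply/BE => i /(XP i).2 inf; have [N NP] := fin i.+1.
have [n Nn xn] := inf N.
have := NP (Cantor.to_nat (i, n)) (leq_trans Nn (leq_to_nat i n).2).
by rewrite rowE colE ltnn => /(_ xn).
Qed.

End Reductions.

(** * Hardness *)

Section Hardness.
Variable R : realType.

(** Since [bval R s] is the least binary value in the cylinder of [s], the first alternative gives
    the words met by the points of value at most [r]. *)
Definition capped (r : R) (x : nat -> bool) : pred (seq bool) :=
  fun s => (bval R s <= r) || pinned x s.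

Lemma capped_tree (r : R) x : 0 <= r -> is_tree (capped r x).
Proof.
move=> r0; split=> [|s b|s].
- by rewrite /capped /= r0.
- by move=> /orP[|/pinned_rcons] h; apply/orP;
    [left; exact: le_trans (bval_rcons R s b) h|right].
- move=> /orP[sr|/pinned_rcons_true h].
    by exists false; rewrite /capped bval_rcons_false sr.
  by exists true; rewrite /capped h orbT.
Qed.

Lemma loc_cst_pinned {Z : topologicalType} (x : Z -> nat -> bool) s :
  (forall i, loc_cst (fun z => x z i)) -> loc_cst (fun z => pinned (x z) s).
Proof.
elim: s x => [|b s IH] x xl; first by move=> z; exact: filterE.
apply: (loc_cst2 (fun a c => (a ==> b) && c)); first exact: xl.
by apply: IH => i; exact: xl.
Qed.

Lemma loc_cst_comb_word {Z : topologicalType} (x : Z -> nat -> bool) m s :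
  (forall i, loc_cst (fun z => x z i)) -> loc_cst (fun z => comb_word (x z) m s).
Proof.
elim: s x m => [|[] s IH] x m xl; first by move=> z; exact: filterE.
  by apply: (loc_cst_comp (fun a => ~~ (a && prefix (nseq (m 0%N) false) s))).
by apply: IH => i; exact: xl.
Qed.

Lemma exp2_lt (e : R) : 0 < e -> exists N, forall n, (N <= n)%N -> 2 ^- n < e.
Proof.
move=> /ltr_add_invr[N]; rewrite add0r => Ne; exists N => n Nn.
apply: le_lt_trans Ne; rewrite lef_pV2 ?posrE ?exprn_gt0// -natrX ler_nat.
by apply: leq_trans (ltn_expl n _); rewrite ?ltnS.
Qed.

Lemma count_unbounded (x : nat -> bool) :
  (forall N, exists2 k, (N <= k)%N & x k) ->
  forall c, exists N, forall n, (N <= n)%N -> (c <= \sum_(i < n) x i)%N.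
Proof.
move=> inf; elim=> [|c [N NP]]; first by exists 0%N.
have [k Nk xk] := inf N; exists k.+1 => n kn.
rewrite -(subnKC kn) big_split_ord /= big_ord_recr /= xk addn1.
by apply: leq_trans (leq_addr _ _); rewrite ltnS; exact: NP.
Qed.

Lemma capped_le (r : R) (x : nat -> bool) : 0 <= r ->
  (forall N, exists2 k, (N <= k)%N & x k) ->
  forall e, 0 < e -> exists n, freq R n (capped r x) < r + e.
Proof.
move=> r0 inf e e0.
have e20 : 0 < e / 2 by rewrite divr_gt0.
(* One half of [e] absorbs the error of [freq_bval_le], the other the pinned words, which are
   constrained at [N] or more places from level [M] on. *)
have [N NP] := exp2_lt _ e20; have [M MP] := count_unbounded _ inf N.
exists (maxn N M); apply: le_lt_trans (freq_or_le _ _ _ _) _.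
rewrite freq_pinned [e]splitr addrA; apply: ler_ltD; last first.
  by apply: NP; apply: MP; exact: leq_maxr.
apply: (@le_trans _ _ (r + 2 ^- maxn N M)).
  apply: freq_bval_le; apply: le_trans r0.
  by rewrite oppr_le0 invr_ge0 exprn_ge0.
by rewrite lerD2l; apply/ltW/NP; exact: leq_maxl.
Qed.

Lemma capped_gt (r : R) (x : nat -> bool) : 0 <= r < 1 ->
  ~ (forall N, exists2 k, (N <= k)%N & x k) ->
  exists2 e, 0 < e & \forall n \near \oo, r + e <= freq R n (capped r x).
Proof.
move=> /andP[r0 r1] fin.
have [N NP] : exists N, forall k, (N <= k)%N -> ~~ x k.
  apply: contrapT => no; apply: fin => N; apply: contrapT => no1.
  by apply: no; exists N => k Nk; apply/negP => xk; apply: no1; exists k.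
have [M MP] : exists M, forall n, (M <= n)%N -> 2 ^- n < 1 - r.
  by apply: exp2_lt; rewrite subr_gt0.
(* Words beginning with [L] ones are pinned, as [x] vanishes from [N] on, and have value above [r],
   as [2 ^- L < 1 - r]. They therefore add [2 ^- L] to the frequency. *)
pose L := maxn N M.
have L0 : 0 < 2 ^- L :> R by rewrite invr_gt0 exprn_gt0.
exists (2 ^- L) => //; exists L => // n /= Ln.
apply: (@le_trans _ _
  (freq R n (fun s => (bval R s <= r) || prefix (nseq L true) s))).
  rewrite freq_or; last first.
    move=> s _; apply: contraL => /(bval_ones R) h; rewrite -ltNge.
    by apply: lt_le_trans h; have := MP L (leq_maxr _ _); lra.
  rewrite freq_prefix1 ?size_nseq// lerD2r; apply: freq_bval_ge; exact: ltW.
apply: le_freq => s _ /orP[h|h]; apply/orP; [by left|right].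
by apply: pinned_ones h => k; move=> /(leq_trans (leq_maxl _ _)); exact: NP.
Qed.

Lemma muKN0 (K : hyperspace) (z : cantor_space) : muKN R K z 0 = mu R (sval K).
Proof.
rewrite /muKN (_ : cyl _ = setT) ?setIT//.
by apply/seteqP; split=> // y _ i.
Qed.

Lemma section_hard (r : I01 R) (z : cantor_space) : sval r < 1 ->
  Gamma_hard R (PI0 2) [set K : hyperspace | A_le R (K, z, 0%N, r)].
Proof.
move=> r1 Z pZ zZ B /(Pi2_reduction _ _ _ pZ zZ)[x [xl xB]].
have /andP[r0 _] : 0 <= sval r <= 1 by have := svalP r; rewrite inE.
have tT w : is_tree (capped (sval r) (x w)) by exact: capped_tree.
exists (fun w => tree_body (capped (sval r) (x w))); split.
  apply: continuous_tree_body => // s.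
  apply: (loc_cst_comp (fun b => (bval R s <= sval r) || b)).
  exact: loc_cst_pinned.
apply/seteqP; split=> w /=; rewrite xB /A_le /= muKN0 /= => h.
  apply/lee_addgt0Pr => e /(capped_le _ _ r0 h)[n nr].
  apply: le_trans (mu_le_freq _ _ n) _; rewrite -EFinD lee_fin; apply: ltW.
  by rewrite (eq_freq _ _ _ (capped (sval r) (x w)))// => s _; rewrite hits_body.
have r01 : 0 <= sval r < 1 by rewrite r0 r1.
apply: contrapT => /(capped_gt _ _ r01)[e e0 eN].
have : (mu R (body (capped (sval r) (x w))) < (sval r + e)%:E)%E.
  by apply: le_lt_trans h _; rewrite lte_fin ltrDl.
move=> /(mu_lt_near _ _ _ (compact_body _))/(filterI eN)/filter_ex[n []].
by rewrite leNgt (eq_freq _ _ _ _ (fun s _ => hits_body _ s (tT w))) => /negP.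
Qed.

(** This carries hardness from a section to the whole set. *)
Lemma hard_preimage (Gamma : forall T : topologicalType, set (set T))
    (X Y : topologicalType) (g : X -> Y) (A : set Y) : continuous g ->
  Gamma_hard R Gamma (g @^-1` A) -> Gamma_hard R Gamma A.
Proof.
move=> gc gA Z pZ zZ B /(gA Z pZ zZ)[f [fc ->]]; exists (g \o f); split=> //.
by move=> z; apply: continuous_comp; [exact: fc|exact: gc].
Qed.

Lemma hardC k (X : topologicalType) (A : set X) :
  Gamma_hard R (PI0 k) A -> Gamma_hard R (SIGMA0 k) (~` A).
Proof.
move=> hA Z pZ zZ B sB; have [|f [fc Bf]] := hA Z pZ zZ (~` B).
  by rewrite /PI0 /Pi0 /mkset setCK.
by exists f; split=> //; rewrite -preimage_setC -Bf setCK.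
Qed.

Definition mk01 (r : R) (h : unit01 r) : I01 R := exist _ r (mem_set h).

Let unit01_0 : unit01 (0 : R). Proof. by rewrite /unit01 /= lexx ler01. Qed.
Let unit01_1 : unit01 (1 : R). Proof. by rewrite /unit01 /= ler01 lexx. Qed.
Let unit01_half : unit01 (1 / 2 : R).
Proof. by rewrite /unit01 /=; apply/andP; split; lra. Qed.

Let zeros : cantor_space := fun=> false.

Lemma continuous_pair {T X Y : topologicalType} (f : T -> X) (g : T -> Y) :
  continuous f -> continuous g -> continuous (fun z => (f z, g z)).
Proof. by move=> fc gc z; apply: cvg_pair; [exact: fc|exact: gc]. Qed.

Lemma A_section_continuous (z : cantor_space) (r : I01 R) :
  continuous (fun K : hyperspace => (K, z, 0%N, r)).
Proof.
apply: continuous_pair; last exact: cst_continuous.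
apply: continuous_pair; last exact: cst_continuous.
apply: continuous_pair; last exact: cst_continuous.
by move=> K; exact: cvg_id.
Qed.

Lemma A_le_hard : Gamma_hard R (PI0 2) (A_le R).
Proof.
apply: (hard_preimage _ _ _ _ _ (A_section_continuous zeros (mk01 _ unit01_0))).
by apply: section_hard => /=.
Qed.

Lemma A_eq_hard : Gamma_hard R (PI0 2) (A_eq R).
Proof.
apply: (hard_preimage _ _ _ _ _ (A_section_continuous zeros (mk01 _ unit01_0))).
(* At [r = 0], having measure at most [r] and having measure equal to [r] coincide. *)
rewrite (_ : _ @^-1` _ = [set K : hyperspace |
    A_le R (K, zeros, 0%N, mk01 _ unit01_0)]).
  by apply: section_hard => /=.
apply/seteqP; split=> K; rewrite /A_le /A_eq /= => h; first by rewrite h.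
by apply/eqP; rewrite eq_le h mu_ge0.
Qed.

(** * Densities of combs at the zero sequence *)

Definition comb (x : nat -> bool) m : hyperspace := tree_body (comb_word x m).

Lemma comb_is_tree x m : is_tree (comb_word x m).
Proof.
split=> //; [exact: comb_word_rcons|exact: comb_word_extend].
Qed.

Lemma comb_continuous {Z : topologicalType} (x : Z -> nat -> bool) m (r : I01 R) :
  (forall i, loc_cst (fun z => x z i)) ->
  continuous (fun z => (comb (x z) m, zeros, r)).
Proof.
move=> xl; apply: continuous_pair; last exact: cst_continuous.
apply: continuous_pair; last exact: cst_continuous.
apply: (continuous_tree_body (fun z => comb_word (x z) m)) => [w|s].
  exact: comb_is_tree.
exact: loc_cst_comb_word.
Qed.

(** Above the word of [n] zeros, the tree of a comb is again such a tree, with both sequences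
    shifted by [n]. *)
Lemma comb_density_ltP x m n (r : R) :
  (dens_ratio R (comb x m) zeros n < r%:E)%E <->
  exists j, freq R j (comb_word (fun k => x (n + k)%N) (fun k => m (n + k)%N)) < r.
Proof.
have E j : freq R j (fun s => hits (sval (comb x m)) (restr zeros n ++ s)) =
    freq R j (comb_word (fun k => x (n + k)%N) (fun k => m (n + k)%N)).
  apply: eq_freq => s _; rewrite hits_body; last exact: comb_is_tree.
  rewrite -comb_word_zeros; congr (comb_word x m (_ ++ s)).
  by apply: (@eq_from_nth _ false); rewrite size_mkseq ?size_nseq// => i im;
    rewrite nth_mkseq// nth_nseq im.
by rewrite dens_ratio_ltP; split=> -[j]; rewrite ?E => h; exists j; rewrite ?E.
Qed.

Lemma comb_density_lt (x : nat -> bool) m n (r : R) : x n -> 1 - 2 ^- (m n).+1 < r ->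
  (dens_ratio R (comb x m) zeros n < r%:E)%E.
Proof.
move=> xn mr; apply/comb_density_ltP; exists (m n).+1; apply: le_lt_trans mr.
have := freq_comb_word_le R (fun k => x (n + k)%N) (fun k => m (n + k)%N).
by rewrite !addn0; apply.
Qed.

Lemma comb_density_ge (x : nat -> bool) m n M :
  (forall k, (n <= k)%N -> x k -> (M <= m k)%N) ->
  ((1 - 2 ^- M)%:E <= dens_ratio R (comb x m) zeros n)%E.
Proof.
move=> nM; rewrite leNgt; apply/negP => /comb_density_ltP[j].
apply/negP; rewrite -leNgt; apply: freq_comb_word_ge => k; apply: nM.
exact: leq_addr.
Qed.

(** A one at [k] brings the ratio at [k] down to [1 - 2 ^- (m k).+1] or less; the strict inequality
    [m k < M] accounts for the successor. *)
Lemma comb_liminf_le (x : nat -> bool) m c M :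
  (forall N, exists2 k, (N <= k)%N & x k && (m k < M)%N) ->
  1 - 2 ^- M <= c -> (Dminus R (comb x m) zeros <= c%:E)%E.
Proof.
move=> inf Mc; rewrite leNgt; apply/negP => /lt_limn_einfP[k [N NP]].
have [n Nn /andP[xn mM]] := inf N.
have := NP n Nn; rewrite leNgt => /negP; apply; apply: comb_density_lt => //.
apply: (@le_lt_trans _ _ c); last by rewrite ltrDl invr_gt0.
apply: le_trans Mc; rewrite lerD2l lerN2 lef_pV2 ?posrE ?exprn_gt0//.
by rewrite ler_weXn2l ?ler1n.
Qed.

Lemma comb_liminf_gt (x : nat -> bool) m c M :
  (exists N, forall k, (N <= k)%N -> x k -> (M <= m k)%N) ->
  c < 1 - 2 ^- M -> (c%:E < Dminus R (comb x m) zeros)%E.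
Proof.
move=> [N NP] /ltr_add_invr[k kM]; apply/lt_limn_einfP; exists k, N => n Nn.
apply: (@le_trans _ _ (1 - 2 ^- M)%:E); first by rewrite lee_fin ltW.
by apply: comb_density_ge => i ni; apply: NP; exact: leq_trans ni.
Qed.

Lemma Bm_le_hard : Gamma_hard R (PI0 2) (Bm_le R).
Proof.
move=> Z pZ zZ B /(Pi2_reduction _ _ _ pZ zZ)[x [xl xB]].
exists (fun z => (comb (x z) (fun=> 0%N), zeros, mk01 _ unit01_half)).
split; first exact: comb_continuous.
apply/seteqP; split=> z; rewrite xB /Bm_le /= => h.
  apply: (comb_liminf_le _ _ _ 1); last by rewrite expr1; lra.
  by move=> N; have [k Nk xk] := h N; exists k; rewrite ?xk.
apply: contrapT => fin; move: h; apply/negP; rewrite -ltNge.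
(* With no ones from some place on, the condition on [m] is vacuous for every [M]; the value 2 gives
   [3 / 4], above [1 / 2]. *)
apply: (comb_liminf_gt _ _ _ 2); last by rewrite expr2; lra.
apply: contrapT => no; apply: fin => N; apply: contrapT => no1; apply: no.
by exists N => k Nk xk; exfalso; apply: no1; exists k.
Qed.

Lemma comb_liminf_ge1P (x : nat -> bool) m :
  (1%:E <= Dminus R (comb x m) zeros)%E <->
  forall M, exists N, forall k, (N <= k)%N -> x k -> (M <= m k)%N.
Proof.
split=> [D1 M|fin].
  apply: contrapT => no.
  have : (Dminus R (comb x m) zeros <= (1 - 2 ^- M)%:E)%E.
    apply: comb_liminf_le (lexx _) => N; apply: contrapT => no1; apply: no.
    exists N => k Nk xk; rewrite leqNgt; apply/negP => kM; apply: no1.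
    by exists k => //; rewrite xk.
  move=> /(le_trans D1); apply/negP; rewrite -ltNge lte_fin ltrBlDr ltrDl.
  by rewrite invr_gt0 exprn_gt0.
rewrite leNgt; apply/negP => /lte_subr_invP[k].
have k0 : 0 < k.+1%:R^-1 :> R by rewrite invr_gt0.
have [M MP] := exp2_lt _ k0.
apply/negP; rewrite -ltNge; apply: (comb_liminf_gt _ _ _ M (fin M)).
by rewrite ltrD2l ltrN2; exact: MP.
Qed.

Lemma Bm_ge_hard : Gamma_hard R (PI0 3) (Bm_ge R).
Proof.
move=> Z pZ zZ B /(Pi3_reduction _ _ _ pZ zZ)[x [m [xl xB]]].
exists (fun z => (comb (x z) m, zeros, mk01 _ unit01_1)).
split; first exact: comb_continuous.
by apply/seteqP; split=> z; rewrite xB /Bm_ge /= comb_liminf_ge1P.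
Qed.

(** The ratios never exceed 1, so a lower limit of at least 1 forces convergence. Hence the
    reduction for [Bm_ge] at [r = 1] also serves for [B_eq]. *)
Lemma dens_ratio_cvg1P (K : hyperspace) (z : cantor_space) :
  dens_ratio R K z @ \oo --> 1%:E <-> (1%:E <= Dminus R K z)%E.
Proof.
split=> [/cvg_limn_einf_sup[D1 _]|D1]; first by rewrite /Dminus D1.
apply: cvg_EFin; first exact: nearW.
apply/cvgrPdist_lt => e e0.
have : ((1 - e)%:E < Dminus R K z)%E.
  by apply: lt_le_trans D1; rewrite lte_fin ltrBlDr ltrDl.
move=> /lt_limn_einfP[k [N NP]]; exists N => // n /= /NP.
rewrite /dens_ratio; set q := _ / _; rewrite lee_fin => qe.
have q1 : q <= 1.
  rewrite leNgt; apply/negP => q1.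
  have : (dens_ratio R K z n < q%:E)%E.
    by apply/dens_ratio_ltP; exists 0%N; exact: le_lt_trans (freq_le1 _ _ _) q1.
  by rewrite ltxx.
rewrite /comp /= -/q ger0_norm ?subr_ge0// ltrBlDr -ltrBlDl.
by apply: lt_le_trans qe; rewrite ltrDl.
Qed.

Lemma B_eq_hard : Gamma_hard R (PI0 3) (B_eq R).
Proof.
move=> Z pZ zZ B /(Pi3_reduction _ _ _ pZ zZ)[x [m [xl xB]]].
exists (fun z => (comb (x z) m, zeros, mk01 _ unit01_1)).
split; first exact: comb_continuous.
by apply/seteqP; split=> z; rewrite xB /B_eq /= dens_ratio_cvg1P comb_liminf_ge1P.
Qed.

End Hardness.

Theorem theorem3p2 (R : realType) :
  (* (a) *)
  ((forall (r : I01 R) (z : cantor_space), sval r < 1 ->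
      Gamma_complete R (PI0 2) [set K : hyperspace | A_le R (K, z, 0%N, r)] /\
      Gamma_complete R (SIGMA0 2) (~` [set K : hyperspace | A_le R (K, z, 0%N, r)])) /\
   Gamma_complete R (PI0 2) (A_le R) /\
   Gamma_complete R (SIGMA0 2) (A_gt R) /\
   Gamma_complete R (PI0 2) (A_eq R)) /\
  (* (b) *)
  (Gamma_complete R (PI0 2) (Bm_le R) /\
   Gamma_complete R (PI0 3) (Bm_ge R) /\
   Gamma_complete R (SIGMA0 2) (Bm_gt R) /\
   Gamma_complete R (SIGMA0 3) (Bm_lt R) /\
   Gamma_hard R (PI0 3) (B_eq R)).
Proof.
have hA (r : I01 R) z r1 := section_hard R r z r1.
split; first split; [|split; [|split]|].
- move=> r z r1; have S2 : Pi0 2 [set K : hyperspace | A_le R (K, z, 0%N, r)].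
    apply: (Pi2_preimage (fun K : hyperspace => (K, z, 0%N, r)) _ _ (Pi2_A_le R)).
    exact: A_section_continuous.
  by split; split=> //; [exact: hA|exact/hardC/hA].
- by split; [exact: Pi2_A_le|exact: A_le_hard].
- split; first exact: Sigma2_A_gt.
  by rewrite -setC_A_le; apply: hardC; exact: A_le_hard.
- by split; [exact: Pi2_A_eq|exact: A_eq_hard].
split; first by split; [exact: Pi2_Bm_le|exact: Bm_le_hard].
split; first by split; [exact: Pi3_Bm_ge|exact: Bm_ge_hard].
split.
  split; first exact: Sigma2_Bm_gt.
  by rewrite -setC_Bm_le; apply: hardC; exact: Bm_le_hard.
split; last exact: B_eq_hard.
split; first exact: Sigma3_Bm_lt.
by rewrite -setC_Bm_ge; apply: hardC; exact: Bm_ge_hard.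
Qed.
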